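(* Let $f:S^1\to S^1$ be a $C^2$-smooth endomorphism with $\lambda=\min_{y\in S^1}f'(y)>1$, let $0<\theta<1$, and let $v:S^1\to\mathbb R$ be a $C^1$ function. For every positive natural number $r$, the only bounded solution $\alpha:S^1\to\mathbb R$ of $$v(E_r(x))=\alpha(f(x))-(f'(x))^{\theta}\alpha(x),\qquad x\in S^1,$$ is $\theta$-Hölder at every point. In other words, $h_x(\alpha)\ge\theta$ for every $x\in S^1$.
   Context: $S^1=\mathbb R/\mathbb Z$ and $E_r(x)=rx \pmod 1$. The displayed equation has exactly one bounded solution, $\alpha(x)=-\sum_{i=0}^\infty \frac{v(E_r(f^i(x)))}{((f^{i+1})'(x))^\theta}$. A function $\phi$ is $\gamma$-Hölder at $x$ if there is $C>0$ with $|\phi(x)-\phi(y)|\le C|x-y|^\gamma$ for all $y$ in a neighbourhood of $x$. For a function $\omega$, the (optimal) Hölder exponent at the point $x$ is $$h_x(\omega)=\liminf_{y\to x,\ y\ne x}\frac{\log|\omega(x)-\omega(y)|}{\log|x-y|},$$ where the quotient is taken to be $+\infty$ if $\omega(y)=\omega(x)$. *)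

(* Defs.v *)
From HB Require Import structures.
From mathcomp Require Import all_boot all_order all_algebra.
From mathcomp Require Import generic_quotient ring_quotient.
From mathcomp Require Import all_classical all_reals all_analysis.
From mathcomp Require Import zify lra.

Set Implicit Arguments.
Unset Strict Implicit.
Unset Printing Implicit Defensive.

Import Order.TTheory GRing.Theory Num.Theory.
Import numFieldNormedType.Exports.

Local Open Scope classical_set_scope.
Local Open Scope quotient_scope.
Local Open Scope ring_scope.

(* the additive subgroup of t : R such that t \is a Num.int *)
Definition int_subgroup (R : realType) : zmodClosed R :=
  GRing.ZmodClosed.clone R (@Num.int_num_subdef R) _.

Definition circle (R : realType) : Type := Quotient.quot (int_subgroup R).

HB.instance Definition _ (R : realType) := GRing.Zmodule.on (circle R).

Section Circle.
Variable R : realType.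
Implicit Types (t u : R) (x y z : circle R).

Definition circle_proj (t : R) : circle R :=
  \pi_(Quotient.quot (int_subgroup R)) t.

(* the representative in [-1/2, 1/2[ *)
Definition circle_repr (x : circle R) : R :=
  let t : R := repr (x : Quotient.quot (int_subgroup R)) in
  t - (Num.floor (t + 2^-1))%:~R.

Lemma circle_proj_eq t u : circle_proj t = circle_proj u <-> t - u \is a Num.int.
Proof.
split=> [|H]; last by apply/eqP; rewrite /circle_proj -Quotient.idealrBE.
by rewrite /circle_proj => /eqP; rewrite -Quotient.idealrBE.
Qed.

Lemma circle_projD t u : circle_proj (t + u) = circle_proj t + circle_proj u.
Proof. exact: (Quotient.pi_add (int_subgroup R)). Qed.

Lemma circle_projN t : circle_proj (- t) = - circle_proj t.
Proof. exact: (Quotient.pi_opp (int_subgroup R)). Qed.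

Lemma circle_proj0 : circle_proj 0 = 0.
Proof. by apply: (addIr (circle_proj 0)); rewrite -circle_projD !add0r. Qed.

Lemma circle_reprK x : circle_proj (circle_repr x) = x.
Proof.
rewrite -[RHS](reprK (x : Quotient.quot (int_subgroup R))).
apply/circle_proj_eq; rewrite /circle_repr addrAC subrr add0r rpredN.
exact: intr_int.
Qed.

Lemma circle_repr_itv x : - 2^-1 <= circle_repr x < 2^-1.
Proof.
rewrite /circle_repr; set t := repr _.
have := floor_itv (t + 2^-1).
move: (Num.floor _) => m; rewrite intrD => /andP[h1 h2]; apply/andP; split.
  by rewrite lerBrDr addrC lerBlDr.
rewrite ltrBlDr -(ltrD2r 2^-1) (lt_le_trans h2)// addrAC addrC lerD2l.
by rewrite -[leRHS]mulr2n -(mulr_natl 2^-1) divff.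
Qed.

Lemma circle_repr_le x t : circle_proj t = x -> `|circle_repr x| <= `|t|.
Proof.
move=> tx; have := circle_repr_itv x => /andP[h1 h2].
have := circle_reprK x; rewrite -{}tx in h1 h2 *.
set s := circle_repr _ in h1 h2 * => /circle_proj_eq/intrP[m sm].
have s2 : `|s| <= 2^-1 by rewrite ler_norml h1 ltW.
have [m0|m0] := eqVneq m 0.
  by move/eqP: sm; rewrite m0 subr_eq0 => /eqP ->.
have m1 : 1 <= `|m%:~R : R|.
  by rewrite -intr_norm -[1]/(1%:~R) ler_int -gtz0_ge1 normr_gt0.
have : 1 <= `|s| + `|t| by rewrite (le_trans m1)// -sm ler_normB.
have -> : 1 = 2^-1 + 2^-1 :> R by rewrite -mulr2n -(mulr_natl 2^-1) divff.
by move=> H; rewrite (le_trans s2)// -(lerD2l `|s|) (le_trans _ H)// lerD2r.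
Qed.

Lemma circle_repr_small t : `|t| < 2^-1 -> circle_repr (circle_proj t) = t.
Proof.
move=> t2; have /circle_proj_eq/intrP[m mE] := circle_reprK (circle_proj t).
have /andP[h1 h2] := circle_repr_itv (circle_proj t).
have H : `|m%:~R : R| < 1.
  move: t2; rewrite -mE !ltr_norml => /andP[h3 h4]; apply/andP; split; lra.
have m0 : m = 0.
  move: H; rewrite -intr_norm -[1]/(1%:~R) ltr_int; lia.
by move/eqP: mE; rewrite m0 subr_eq0 => /eqP.
Qed.

Let dist x y := `|circle_repr (y - x)|.

Let distxx x : dist x x = 0.
Proof.
apply/eqP; rewrite eq_le normr_ge0 andbT -(normr0 R).
by apply: circle_repr_le; rewrite subrr circle_proj0.
Qed.

Let dist_positivity x y : dist x y = 0 -> x = y.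
Proof.
move=> /normr0_eq0 xy0; apply/esym/eqP.
by rewrite -subr_eq0 -(circle_reprK (y - x)) xy0 circle_proj0.
Qed.

Let dist_le x y : dist x y <= dist y x.
Proof.
rewrite /dist -[leRHS]normrN; apply: circle_repr_le.
by rewrite circle_projN circle_reprK opprB.
Qed.

Let dist_sym x y : dist x y = dist y x.
Proof. by apply/eqP; rewrite eq_le !dist_le. Qed.

Let dist_triangle y x z : dist x z <= dist x y + dist y z.
Proof.
apply: le_trans (ler_normD _ _); apply: circle_repr_le.
by rewrite circle_projD !circle_reprK addrC addrA subrK.
Qed.

HB.instance Definition _ := isMetric.Build R (circle R)
  distxx dist_positivity dist_sym dist_triangle.

Lemma circle_mdistE x y : mdist x y = `|circle_repr (y - x)|.
Proof. by []. Qed.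

End Circle.

Section Smoothness.
Variable R : realType.

Definition Ck (k : nat) (g : R -> R) : Prop :=
  (forall i, (i < k)%N -> forall t, derivable (derive1n i g) t 1) /\
  continuous (derive1n k g).

Definition Ck_circle_fun (k : nat) (v : circle R -> R) : Prop :=
  Ck k (v \o @circle_proj R).

(* A C^k self-map of R/Z, of arbitrary degree, is one with a C^k lift. *)
Definition Ck_circle_map (k : nat) (f : circle R -> circle R) : Prop :=
  exists2 F : R -> R,
    (forall t, f (circle_proj t) = circle_proj (F t)) & Ck k F.

(* Derivative in the charts h |-> x + h around x and
   z |-> circle_repr (z - f x) around f x. *)
Definition circle_derive (f : circle R -> circle R) (x : circle R) : R :=
  derive1 (fun h : R => circle_repr (f (x + circle_proj h) - f x)) 0.

Lemma circle_derive_lift f (F : R -> R) t :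
  (forall u, f (circle_proj u) = circle_proj (F u)) ->
  derivable F t 1 -> circle_derive f (circle_proj t) = derive1 F t.
Proof.
move=> fF dF; rewrite /circle_derive !derive1E.
have -> : 'D_1 F t = 'D_1 (fun h => F (t + h) - F t) 0.
  rewrite /derive.
  set g1 := (X in lim (X @ _)); set g2 := (X in _ = lim (X @ _)).
  suff -> : g1 = g2 by [].
  apply/funext => h; rewrite /g1 /g2 /=.
  by rewrite !addr0 subrr subr0 [t + _]addrC.
apply: near_eq_derive.
have cF : {for t, continuous F}.
  by apply: differentiable_continuous; exact/derivable1_diffP.
have c1 : {for (0:R), continuous (fun h => t + h)}.
  by apply: cvgD; [exact: cvg_cst|exact: cvg_id].
have c2 : {for (0:R), continuous (F \o (fun h => t + h))}.
  by apply: continuous_comp => //; rewrite addr0.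
have c3 : (fun h => F (t + h) - F t) @ (0:R) --> (0:R).
  have := cvgB c2 (cvg_cst (F t) : (fun _ => F t) @ (0:R) --> F t).
  by rewrite /= addr0 subrr; apply.
have h2 : (0 : R) < 2^-1 by rewrite invr_gt0 ltr0n.
have := (@cvgr0_norm_lt _ _ _ _ _ _ c3 _ h2).
move=> hn; near=> h.
have hlt : `|F (t + h) - F t| < 2^-1 by near: h; exact: hn.
by rewrite -circle_projD !fF -circle_projN -circle_projD circle_repr_small.
Unshelve. all: by end_near.
Qed.

Definition circle_mul (r : nat) (x : circle R) : circle R := x *+ r.

End Smoothness.

Section Holder.
Variable R : realType.

Definition holder_at (gamma : R) (phi : circle R -> R) (x : circle R) : Prop :=
  exists2 C : R, 0 < C &
    \forall y \near x, `|phi x - phi y| <= C * mdist x y `^ gamma.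

(* mdist x y <= 1/2, so that the denominator is nonzero for y != x. *)
Definition holder_quotient (w : circle R -> R) (x y : circle R) : \bar R :=
  if w y == w x then +oo%E
  else (ln `|w x - w y| / ln (mdist x y))%:E.

Definition holder_exponent (w : circle R -> R) (x : circle R) : \bar R :=
  limf_einf (holder_quotient w x) x^'.

End Holder.

Definition bounded_solution (R : realType) (f : circle R -> circle R)
    (theta : R) (w : circle R -> R) (alpha : circle R -> R) : Prop :=
  bounded_fun alpha /\
  forall x, w x = alpha (f x) - circle_derive f x `^ theta * alpha x.

(* Main.v *)
Require Import Defs.
From mathcomp Require Import all_boot all_order all_algebra.
From mathcomp Require Import all_classical all_reals all_analysis.
From mathcomp Require Import ring lra.

(** Write [w] for [v] after multiplication by [r], and [psi] for the power
    [theta] of [f'].  The equation [alpha = (alpha \o f - w) / psi] has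
    [psi >= lambda `^ theta > 1], so it is a contraction on bounded functions:
    iterating it gives a geometrically dominated series that solves it
    ([twisted_equation_solvable]), and the difference of two bounded solutions
    is divided by [lambda `^ theta] at each step backwards, hence is zero
    ([twisted_equation_unique]).

    For the regularity, lift everything to the line: [F] is a lift of [f],
    [g = F'] and [A] is the lift of [alpha].  Subtracting the equations at [x]
    and [y], and using that [w] and [psi] are Lipschitz and [A] is bounded,
    gives, for [D = |x - y|] and some constant [L],
      [g x `^ theta * |A x - A y| <= |A (F x) - A (F y)| + L * D].
    On the other hand the distance [D'] from [F x] to [F y] satisfies
      [D' `^ theta <= g x `^ theta * (1 + k * D) * D `^ theta],
    because [g] is [k]-Lipschitz.  A bound
    [|A (F x) - A (F y)| <= a * D' `^ theta] is thus carried back to [x] and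
    [y] with the same power of the distance, up to a factor [1 + k * D] and an
    error [L * D].  Both are [O(D)] with [D = D `^ (1 - theta) * D `^ theta],
    and the distances grow at least by the factor [lambda] under [F], so the
    accumulated loss is a geometric sum: this is where [theta < 1] is used.
    [holder_bootstrap] runs this as an induction on the number of iterates
    needed to separate the points by a definite distance, at which the
    boundedness of [A] suffices.  To close the induction without following the
    accumulated constants it proves the slightly stronger bound
    [a * (1 - beta * D `^ (1 - theta)) * D `^ theta], whose gain when [D] is
    multiplied by [lambda] pays for the loss of one step.

    The bound on the pointwise exponent is then [holder_exponent_ge], valid at
    any point where a function is [theta]-Hölder. *)

Set Implicit Arguments.
Unset Strict Implicit.

Import Order.TTheory GRing.Theory Num.Theory.
Import numFieldNormedType.Exports.

Local Open Scope classical_set_scope.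
Local Open Scope ring_scope.

(** * Periodic functions of class C^1 *)

Section PeriodicFunctions.
Variable R : realType.
Implicit Types (h : R -> R) (t s K : R).

Lemma periodic_int h : (forall t, h (t + 1) = h t) ->
  forall (m : int) t, h (t + m%:~R) = h t.
Proof.
move=> hp.
have hn (n : nat) t : h (t + n%:R) = h t.
  elim: n => [|n IH]; first by rewrite addr0.
  by rewrite -natr1 addrA hp.
case=> n t; first exact: hn.
by rewrite NegzE intrN -[LHS](hn n.+1) subrK.
Qed.

Lemma derivable_continuous h : (forall t, derivable h t 1) -> continuous h.
Proof.
by move=> hd t; apply: differentiable_continuous; exact/derivable1_diffP.
Qed.

Lemma continuous_periodic_bounded h : (forall t, h (t + 1) = h t) ->
  continuous h -> exists2 K, 0 < K & forall t, `|h t| <= K.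
Proof.
move=> hp hc.
have hn : {within `[(0 : R), 1], continuous (fun t => `|h t|)}.
  apply: continuous_subspaceT => t.
  by apply: continuous_comp; [exact: hc|exact: norm_continuous].
have [c _ cmax] := EVT_max ler01 hn.
exists (`|h c| + 1) => [|t]; first by rewrite ltr_wpDl.
rewrite -[t](subrK (Num.floor t)%:~R) periodic_int//.
apply: le_trans (_ : `|h c| <= _); last by rewrite lerDl.
apply: cmax; have /andP[t1 t2] := floor_itv t.
rewrite in_itv /= subr_ge0 t1 /= lerBlDl.
by move: t2; rewrite intrD => /ltW.
Qed.

Lemma periodic_derive1 h : (forall t, h (t + 1) = h t) ->
  forall t, derive1 h (t + 1) = derive1 h t.
Proof.
move=> hp t; rewrite /derive1.
set g1 := (X in lim (X @ _)); set g2 := (X in _ = lim (X @ _)).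
suff -> : g1 = g2 by [].
by apply/funext => s; rewrite /g1 /g2 /= addrA !hp.
Qed.

(** The mean value theorem with no assumption on the order of [s] and [t]; the
    intermediate point is only located by its distance to [s]. *)
Lemma mean_value h : (forall t, derivable h t 1) -> forall s t,
  exists2 c, `|c - s| <= `|t - s| & h t - h s = derive1 h c * (t - s).
Proof.
move=> hd.
have hD (x : R) : is_derive x 1 h (derive1 h x).
  by rewrite derive1E; apply/derivableP.
have hc (A : set R) : {within A, continuous h}.
  exact/continuous_subspaceT/derivable_continuous.
move=> s t; have [st|/ltW ts] := leP s t.
  have [c] := MVT_segment st (fun x _ => hD x) (hc _).
  rewrite in_itv => /andP[sc ct] E; exists c => //.
  by rewrite !ger0_norm ?subr_ge0// lerD2r.
have [c] := MVT_segment ts (fun x _ => hD x) (hc _).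
rewrite in_itv => /andP[sc ct] E; exists c => //.
  by rewrite !ler0_norm ?subr_le0// lerN2 lerD2r.
by rewrite -opprB E -mulrN opprB.
Qed.

Lemma bounded_derive1_lipschitz h K : (forall t, derivable h t 1) ->
  (forall t, `|derive1 h t| <= K) ->
  forall s t, `|h s - h t| <= K * `|s - t|.
Proof.
move=> hd hK s t; have [c _ ->] := mean_value hd t s.
by rewrite normrM ler_wpM2r.
Qed.

Lemma Ck_derive1 n h : Ck n.+1 h -> Ck n (derive1 h).
Proof.
by move=> [hd hc]; split=> [i ik|]; rewrite -derive1Sn//; exact: hd.
Qed.

Lemma C1_periodic_lipschitz h : (forall t, h (t + 1) = h t) -> Ck 1 h ->
  exists2 K, 0 < K & forall s t, `|h s - h t| <= K * `|s - t|.
Proof.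
move=> hp [hd hc].
have [K K0 hK] := continuous_periodic_bounded (periodic_derive1 hp) hc.
by exists K => //; apply: bounded_derive1_lipschitz => //; exact: (hd 0).
Qed.

End PeriodicFunctions.

(** * Bounded solutions of a twisted cohomological equation *)

Section TwistedEquation.
Variables (R : realType) (X : Type) (f : X -> X) (psi w : X -> R) (c B : R).
Hypotheses (c1 : 1 < c) (psic : forall x, c <= psi x).
Hypothesis wB : forall x, `|w x| <= B.

Let c0 : 0 < c. Proof. exact: lt_trans c1. Qed.
Let psi0 x : 0 < psi x. Proof. exact: lt_le_trans (psic x). Qed.
Let q1 : `|c^-1| < 1.
Proof. by rewrite gtr0_norm ?invr_gt0// invf_lt1. Qed.

Lemma bounded_expanded_eq0 (beta : X -> R) (K : R) :
  (forall x, `|beta x| <= K) ->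
  (forall x, c * `|beta x| <= `|beta (f x)|) -> forall x, beta x = 0.
Proof.
move=> bK bf.
have bn n x : `|beta x| <= K * c^-1 ^+ n.
  elim: n x => [|n IH] x; first by rewrite mulr1.
  rewrite exprSr mulrA ler_pdivlMr// mulrC.
  exact: le_trans (bf x) (IH (f x)).
move=> x; apply/normr0_eq0/eqP; rewrite eq_le normr_ge0 andbT.
have cvgq : K * c^-1 ^+ n @[n --> \oo] --> (0 : R).
  by rewrite -[X in _ --> X](mulr0 K); apply: cvgMr; exact: cvg_expr.
rewrite -(cvg_lim _ cvgq)//; apply: limr_ge; first by apply/cvg_ex; exists 0.
by apply: nearW => n; exact: bn.
Qed.

(** The terms of the series obtained by iterating
    [alpha = (alpha \o f - w) / psi] from [0]; the recursion on [f x] makes the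
    equation for the sum a mere shift of the index. *)
Fixpoint solution_term (n : nat) (x : X) : R :=
  if n is m.+1 then solution_term m (f x) / psi x else - w x / psi x.

Let term_le n x : `|solution_term n x| <= geometric B c^-1 n.
Proof.
have B0 : 0 <= B := le_trans (normr_ge0 _) (wB x).
elim: n x => [|n IH] x /=; rewrite normrM normfV (gtr0_norm (psi0 x)).
  rewrite normrN expr0 mulr1 ler_pdivrMr//; apply: le_trans (wB x) _.
  by rewrite ler_peMr// (le_trans (ltW c1)).
rewrite exprSr mulrA; apply: ler_pM => //; first by rewrite invr_ge0 ltW.
by rewrite lef_pV2 ?posrE.
Qed.

Let terms_normally_summable x :
  cvgn [normed series (solution_term ^~ x)].
Proof.
apply: series_le_cvg (is_cvg_geometric_series (a := B) q1) => [n|n|n].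
- exact: normr_ge0.
- exact: le_trans (normr_ge0 _) (term_le n x).
- exact: term_le.
Qed.

Lemma twisted_equation_solvable : exists alpha : X -> R,
  (exists K, forall x, `|alpha x| <= K) /\
  forall x, w x = alpha (f x) - psi x * alpha x.
Proof.
have cvgt x : cvgn (series (solution_term ^~ x)) by exact: normed_cvg.
exists (fun x => limn (series (solution_term ^~ x))); split.
  exists (limn (series (geometric B c^-1))) => x.
  apply: le_trans (lim_series_norm (@terms_normally_summable x)) _.
  apply: lim_series_le => [||n]; last exact: term_le.
    exact: terms_normally_summable.
  exact: is_cvg_geometric_series.
move=> x; have psi_neq0 : psi x != 0 by rewrite gt_eqF.
have E : limn (series (solution_term ^~ x)) =
    - w x / psi x + limn (series (solution_term ^~ (f x))) / psi x.
  apply: cvg_lim => //; rewrite -cvg_shiftS /=.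
  under eq_fun do rewrite /series /= big_nat_recl//= -mulr_suml.
  by apply: cvgD; [exact: cvg_cst|apply: cvgMl; exact: cvgt].
by rewrite E; field.
Qed.

Lemma twisted_equation_unique (alpha beta : X -> R) :
  (exists K, forall x, `|alpha x| <= K) ->
  (exists K, forall x, `|beta x| <= K) ->
  (forall x, w x = alpha (f x) - psi x * alpha x) ->
  (forall x, w x = beta (f x) - psi x * beta x) -> alpha = beta.
Proof.
move=> [K aK] [L bL] aE bE; apply/funext => x; apply/eqP; rewrite -subr_eq0.
apply/eqP; move: x.
apply: (@bounded_expanded_eq0 (fun x => alpha x - beta x) (K + L)) => x.
  by apply: le_trans (ler_normB _ _) _; exact: lerD.
have -> : alpha (f x) - beta (f x) = psi x * (alpha x - beta x).
  by have := aE x; rewrite (bE x) mulrBr; lra.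
by rewrite normrM (gtr0_norm (psi0 x)) ler_wpM2r.
Qed.

End TwistedEquation.

(** * Two inequalities on real powers *)

Lemma powR_gt1 (R : realType) (x p : R) : 1 < x -> 0 < p -> 1 < x `^ p.
Proof.
move=> x1 p0; have : 1 `^ p < x `^ p.
  by apply: gt0_ltr_powR => //; rewrite nnegrE// ltW// (lt_trans _ x1).
by rewrite powR1.
Qed.

(** For [1 <= a <= b], [b `^ theta - a `^ theta] is [a `^ theta] times
    [(b / a) `^ theta - 1], and neither factor decreases when [theta]
    is replaced by [1]. *)
Lemma norm_powRB_le (R : realType) (a b theta : R) :
  0 <= theta <= 1 -> 1 <= a -> 1 <= b ->
  `|a `^ theta - b `^ theta| <= `|a - b|.
Proof.
move=> /andP[t0 t1]; wlog ab : a b / a <= b => [H a1 b1|a1 b1].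
  have [ab|/ltW ba] := leP a b; first exact: H.
  by rewrite distrC [leRHS]distrC; exact: H.
have a0 : 0 < a by exact: lt_le_trans a1.
have b0 : 0 < b by exact: lt_le_trans b1.
rewrite distrC [leRHS]distrC !ger0_norm ?subr_ge0//; last first.
  by apply: ge0_ler_powR; rewrite ?nnegrE// ltW.
have q1 : 1 <= b / a by rewrite ler_pdivlMr// mul1r.
have bE : b = (b / a) * a by rewrite divfK// gt_eqF.
have bp : b `^ theta = (b / a) `^ theta * a `^ theta.
  by rewrite {1}bE powRM// ltW// ?divr_gt0.
have h1 : (b / a) `^ theta <= b / a by exact: ler1_powR.
have h2 : a `^ theta <= a by exact: ler1_powR.
have -> : b `^ theta - a `^ theta = ((b / a) `^ theta - 1) * a `^ theta.
  by rewrite bp; ring.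
have -> : b - a = (b / a - 1) * a by rewrite {1}bE; ring.
have h3 : 0 <= a `^ theta by exact: powR_ge0.
apply: le_trans (_ : (b / a - 1) * a `^ theta <= _).
  by rewrite ler_wpM2r// lerD2r.
by rewrite ler_wpM2l// subr_ge0.
Qed.

(** * Hölder regularity over an expanding map of the line *)

(** Here the equation enters only through the inequality [one_step].  The
    parameters [beta], [delta] and [a] are those of the inductive bound,
    chosen in [twisted_equation_holder]: [beta] is balanced against the
    loss [1 + k * D] of one step, [delta] is a distance up to which the
    correction factor stays at least one half, and [a] absorbs [L] and the
    crude bound [2 * B] at distances above [delta / M]. *)
Section HolderBootstrap.
Variables (R : realType) (F A g : R -> R) (theta lambda M k L B : R).
Let s := 1 - theta.
Hypotheses (theta0 : 0 < theta) (theta1 : theta < 1).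
Hypotheses (lambda1 : 1 < lambda) (k0 : 0 < k) (L0 : 0 < L).
Hypotheses (g1 : forall t, 1 <= g t) (gM : forall t, g t <= M).
Hypothesis AB : forall t, `|A t| <= B.
Hypothesis expand_ge : forall x y, lambda * `|x - y| <= `|F x - F y|.
Hypothesis expand_leM : forall x y, `|F x - F y| <= M * `|x - y|.
Hypothesis expand_le : forall x y,
  `|F x - F y| <= g x * (1 + k * `|x - y|) * `|x - y|.
Hypothesis one_step : forall x y,
  g x `^ theta * `|A x - A y| <= `|A (F x) - A (F y)| + L * `|x - y|.

Variables beta delta a : R.
Hypotheses (beta0 : 0 < beta) (betaE : beta * (lambda `^ s - 1) = k + 1).
Hypotheses (delta0 : 0 < delta) (delta1 : delta <= 1).
Hypothesis powR_le_delta : forall D, 0 <= D -> D <= delta ->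
  beta * D `^ s <= 2^-1.
Hypothesis aL : L <= a.
Hypothesis aB : forall D, delta / M <= D -> 2 * B <= a / 2 * D `^ theta.

Let a0 : 0 < a. Proof. exact: lt_le_trans aL. Qed.
Let g0 t : 0 < g t. Proof. exact: lt_le_trans (g1 t). Qed.
Let M0 : 0 < M. Proof. exact: lt_le_trans (g0 0) (gM 0). Qed.
Let lambda0 : 0 < lambda. Proof. exact: lt_trans lambda1. Qed.
Let s0 : 0 < s. Proof. by rewrite subr_gt0. Qed.

Let A_diff x y : `|A x - A y| <= 2 * B.
Proof.
by apply: le_trans (ler_normB _ _) _; rewrite mulr_natl mulr2n lerD.
Qed.

(** The decreasing factor is what lets the induction close: since [D'] is at
    least [lambda * D], going back from [D'] to [D] raises it by at least
    [a * beta * (lambda `^ s - 1) * D `^ s], which is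
    [a * (k + 1) * D `^ s] by the choice of [beta]. *)
Let H D := a * (1 - beta * D `^ s).

Let H_ge D : 0 <= D -> D <= delta -> a / 2 <= H D.
Proof.
move=> D0 Dd; rewrite /H ler_wpM2l ?(ltW a0)//.
by have := powR_le_delta D0 Dd; lra.
Qed.

Let separated x y : delta / M <= `|x - y| -> `|x - y| <= delta ->
  `|A x - A y| <= H `|x - y| * `|x - y| `^ theta.
Proof.
move=> h1 h2; apply: le_trans (A_diff x y) _; apply: le_trans (aB h1) _.
by rewrite ler_wpM2r ?powR_ge0//; exact: H_ge.
Qed.

Let pull_back x y : x != y -> `|x - y| <= delta -> `|F x - F y| <= delta ->
  `|A (F x) - A (F y)| <= H `|F x - F y| * `|F x - F y| `^ theta ->
  `|A x - A y| <= H `|x - y| * `|x - y| `^ theta.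
Proof.
rewrite -subr_eq0 -normr_gt0.
move: (expand_ge x y) (expand_le x y) (one_step x y).
set D := `|x - y|; set D' := `|F x - F y| => DD' D'D xy D0 Dd D'd IH.
have D'0 : 0 <= D' by exact: normr_ge0.
have D1 : D <= 1 by exact: le_trans Dd delta1.
have DDs : D <= D `^ s.
  by apply: ger1_powR; rewrite ?D0 ?D1// gerBl ltW.
have DE : D = D `^ s * D `^ theta.
  by rewrite -powRD ?subrK ?powRr1// ?(ltW D0)// gt_eqF ?implybT.
have gt1 : 1 <= g x `^ theta.
  by rewrite -(powRr0 (g x)) ler_powR// ltW.
have gt0 : 0 < g x `^ theta by exact: lt_le_trans gt1.
have kD1 : 1 <= 1 + k * D by rewrite lerDl mulr_ge0// ltW.
have D't : D' `^ theta <= g x `^ theta * (1 + k * D) * D `^ theta.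
  apply: le_trans (_ : (g x * (1 + k * D) * D) `^ theta <= _).
    apply: ge0_ler_powR; rewrite ?nnegrE ?(ltW theta0)//.
    exact: le_trans D'D.
  have kD0 : 0 <= 1 + k * D by exact: le_trans kD1.
  have gx0 := ltW (g0 x).
  rewrite !powRM ?mulr_ge0// ?(ltW D0)//.
  rewrite ler_wpM2r ?powR_ge0// ler_wpM2l ?powR_ge0//.
  by apply: ler1_powR => //; exact: ltW.
have HD' : H D' <= a * (1 - beta * (lambda `^ s * D `^ s)).
  rewrite /H ler_wpM2l ?(ltW a0)// lerD2l lerN2 ler_wpM2l ?(ltW beta0)//.
  rewrite -powRM ?(ltW lambda0) ?(ltW D0)//.
  by apply: ge0_ler_powR; rewrite ?nnegrE ?(ltW s0)// mulr_ge0// ltW.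
have HD'0 : 0 <= H D'.
  by apply: le_trans (H_ge D'0 D'd); rewrite divr_ge0// ltW.
(* The losses [a * k * D] and [L * D `^ s] are each compared with [D `^ s]. *)
have key : a * (1 - beta * (lambda `^ s * D `^ s)) * (1 + k * D) +
    L * D `^ s <= H D.
  move: DDs; rewrite /H; set u := D `^ s; set Q := lambda `^ s => Du.
  have u0 : 0 <= u by exact: powR_ge0.
  have bu : 0 <= a * (beta * (Q * u) * (k * D)).
    have Q0 : 0 <= Q by exact: powR_ge0.
    exact: (mulr_ge0 (ltW a0) (mulr_ge0 (mulr_ge0 (ltW beta0)
      (mulr_ge0 Q0 u0)) (mulr_ge0 (ltW k0) (ltW D0)))).
  have ak : a * (k * D) <= a * (k * u) by rewrite !ler_pM2l.
  have Lu : L * u <= a * u by rewrite ler_wpM2r.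
  have -> : a * (1 - beta * u) =
      a * (1 - beta * (Q * u)) + a * (beta * (Q - 1)) * u by ring.
  rewrite betaE; nra.
have AD : g x `^ theta * `|A x - A y| <=
    g x `^ theta * (H D * D `^ theta).
  apply: le_trans xy _.
  apply: le_trans (_ : g x `^ theta * ((a * (1 - beta * (lambda `^ s * D `^ s))
     * (1 + k * D) + L * D `^ s) * D `^ theta) <= _); last first.
    by rewrite ler_wpM2l ?powR_ge0// ler_wpM2r ?powR_ge0.
  rewrite mulrDl mulrDr; apply: lerD.
    apply: le_trans IH _.
    have -> : g x `^ theta * (a * (1 - beta * (lambda `^ s * D `^ s)) *
      (1 + k * D) * D `^ theta) = a * (1 - beta * (lambda `^ s * D `^ s)) *
      (g x `^ theta * (1 + k * D) * D `^ theta) by ring.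
    by apply: ler_pM => //; exact: powR_ge0.
  rewrite {1}DE mulrA ler_peMl// mulr_ge0// ?powR_ge0//.
  by rewrite mulr_ge0 ?powR_ge0// ltW.
by rewrite ler_pM2l in AD.
Qed.

(** One iterate multiplies a distance by at most [M], so an orbit of pairs
    starting below [delta / M] cannot jump over the interval from [delta / M]
    to [delta]; [n] bounds the time needed to reach it. *)
Let iterated_pull_back n x y :
  delta / M <= lambda ^+ n * `|x - y| -> `|x - y| <= delta ->
  `|A x - A y| <= H `|x - y| * `|x - y| `^ theta.
Proof.
elim: n x y => [|n IH] x y; first by rewrite mul1r; exact: separated.
move=> xyn xyd; have [xyM|xyM] := leP (delta / M) `|x - y|.
  exact: separated.
have [->|xy] := eqVneq x y.
  by rewrite !subrr normr0 powR0 ?mulr0// gt_eqF.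
have Fd : `|F x - F y| <= delta.
  apply: le_trans (expand_leM x y) _.
  by rewrite mulrC -ler_pdivlMr// ltW.
apply: pull_back => //; apply: IH => //.
apply: le_trans xyn _; rewrite exprSr -mulrA ler_wpM2l//.
by rewrite exprn_ge0// ltW.
Qed.

Lemma holder_bootstrap x y : `|A x - A y| <= a * `|x - y| `^ theta.
Proof.
have [->|xy] := eqVneq x y.
  by rewrite !subrr normr0 powR0 ?mulr0// gt_eqF.
have D0 : 0 < `|x - y| by rewrite normr_gt0 subr_eq0.
have [xyd|dxy] := leP `|x - y| delta; last first.
  have M1 : 1 <= M by exact: le_trans (g1 0) (gM 0).
  apply: le_trans (A_diff x y) _; apply: le_trans (@aB `|x - y| _) _.
    apply: le_trans (ltW dxy); rewrite ler_pdivrMr// ler_peMr//.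
    exact: ltW.
  rewrite ler_wpM2r ?powR_ge0//; have := a0; lra.
have [n xyn] : exists n, delta / M <= lambda ^+ n * `|x - y|.
  have cvgq : delta / M * lambda^-1 ^+ n @[n --> \oo] --> (0 : R).
    rewrite -[X in _ --> X](mulr0 (delta / M)); apply: cvgMr; apply: cvg_expr.
    by rewrite gtr0_norm ?invr_gt0// invf_lt1.
  have [n _ /(_ n (leqnn n))] := cvgr_le _ cvgq _ D0.
  rewrite /= exprVn ler_pdivrMr ?exprn_gt0// [leRHS]mulrC => h.
  by exists n.
apply: le_trans (iterated_pull_back xyn xyd) _.
rewrite ler_wpM2r ?powR_ge0// /H -[leRHS]mulr1 ler_wpM2l ?(ltW a0)//.
by rewrite gerBl mulr_ge0 ?powR_ge0// ltW.
Qed.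

End HolderBootstrap.

Section HolderRegularity.
Variable R : realType.
Variables (F g A W : R -> R) (theta lambda M k l B : R).
Hypotheses (theta0 : 0 < theta) (theta1 : theta < 1) (lambda1 : 1 < lambda).
Hypotheses (k0 : 0 < k) (l0 : 0 <= l) (B0 : 0 < B).
Hypothesis glambda : forall t, lambda <= g t.
Hypothesis gM : forall t, g t <= M.
Hypothesis gk : forall s t, `|g s - g t| <= k * `|s - t|.
Hypothesis Fg : forall s t, exists2 c, `|c - s| <= `|t - s| &
  F t - F s = g c * (t - s).
Hypothesis Wl : forall s t, `|W s - W t| <= l * `|s - t|.
Hypothesis AB : forall t, `|A t| <= B.
Hypothesis AE : forall t, W t = A (F t) - g t `^ theta * A t.

Let s := 1 - theta.
Let L := l + k * B.
Let s0 : 0 < s. Proof. by rewrite subr_gt0. Qed.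
Let L0 : 0 < L. Proof. by rewrite ltr_wpDl// mulr_gt0. Qed.
Let lambda0 : 0 < lambda. Proof. exact: lt_trans lambda1. Qed.
Let g1 t : 1 <= g t. Proof. exact: le_trans (ltW lambda1) (glambda t). Qed.
Let g0 t : 0 < g t. Proof. exact: lt_le_trans (g1 t). Qed.

Let expand_ge x y : lambda * `|x - y| <= `|F x - F y|.
Proof.
have [c _ ->] := Fg y x; rewrite normrM (gtr0_norm (g0 c)).
exact: ler_wpM2r.
Qed.

Let expand_leM x y : `|F x - F y| <= M * `|x - y|.
Proof.
have [c _ ->] := Fg y x; rewrite normrM (gtr0_norm (g0 c)).
exact: ler_wpM2r.
Qed.

(** The derivative at the intermediate point is replaced by [g x], at the cost
    of a relative error proportional to the distance. *)
Let expand_le x y : `|F x - F y| <= g x * (1 + k * `|x - y|) * `|x - y|.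
Proof.
have [c cx E] := Fg x y; rewrite -normrN opprB E normrM (gtr0_norm (g0 c)).
rewrite (distrC y x); apply: ler_wpM2r => //.
have h1 : g c <= g x + k * `|x - y|.
  have := ler_norm (g c - g x); have := gk c x.
  have : k * `|c - x| <= k * `|x - y| by rewrite ler_pM2l// (distrC x y).
  lra.
apply: le_trans h1 _; rewrite mulrDr mulr1 lerD2l.
by rewrite ler_peMl// mulr_ge0// ltW.
Qed.

Let one_step x y :
  g x `^ theta * `|A x - A y| <= `|A (F x) - A (F y)| + L * `|x - y|.
Proof.
have gx0 : 0 < g x `^ theta by exact: powR_gt0.
rewrite -{1}(gtr0_norm gx0) -normrM.
have -> : g x `^ theta * (A x - A y) = (A (F x) - A (F y)) - (W x - W y)
    - (g x `^ theta - g y `^ theta) * A y.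
  by rewrite !AE; ring.
rewrite /L [(l + _) * _]mulrDl addrA.
apply: le_trans (ler_normB _ _) _; apply: lerD.
  by apply: le_trans (ler_normB _ _) _; rewrite lerD2l.
rewrite normrM mulrAC; apply: ler_pM => //.
apply: le_trans (gk x y); apply: norm_powRB_le => //.
by rewrite !ltW.
Qed.

Let M0 : 0 < M. Proof. exact: lt_le_trans (g0 0) (gM 0). Qed.

Let lambdas : 0 < lambda `^ s - 1.
Proof. by rewrite subr_gt0 powR_gt1. Qed.

Lemma twisted_equation_holder :
  exists2 C, 0 < C & forall x y, `|A x - A y| <= C * `|x - y| `^ theta.
Proof.
have [beta beta0 betaE] : exists2 beta, 0 < beta &
    beta * (lambda `^ s - 1) = k + 1.
  exists ((k + 1) / (lambda `^ s - 1)); first by rewrite divr_gt0// addr_gt0.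
  by rewrite divfK// gt_eqF.
pose delta := Num.min 1 ((2 * beta)^-1 `^ s^-1).
have delta0 : 0 < delta.
  by rewrite lt_min ltr01 powR_gt0// invr_gt0 mulr_gt0.
have dM0 : 0 < (delta / M) `^ theta by rewrite powR_gt0// divr_gt0.
pose a := L + 4 * B / (delta / M) `^ theta.
have aL : L <= a by rewrite lerDl divr_ge0 ?mulr_ge0// ltW.
have a0 : 0 < a by exact: lt_le_trans aL.
exists a => //.
apply: (@holder_bootstrap _ F A g theta lambda M k L B _ _ _ _ _ _ _ _ _ _ _ _
  beta delta) => //.
- by rewrite ge_min lexx.
- move=> D D0; rewrite le_min => /andP[_ Dd].
  have beta2 : 0 <= (2 * beta)^-1 by rewrite invr_ge0 mulr_ge0// ltW.
  have : D `^ s <= (2 * beta)^-1.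
    have -> : (2 * beta)^-1 = (2 * beta)^-1 `^ s^-1 `^ s.
      by rewrite -powRrM mulVf ?powRr1// gt_eqF.
    by apply: ge0_ler_powR; rewrite ?nnegrE ?powR_ge0// ltW.
  by rewrite invfM ler_pdivlMr// mulrC.
- move=> D dD; apply: le_trans (_ : a / 2 * (delta / M) `^ theta <= _).
    rewrite -ler_pdivrMr// ler_pdivlMr// mulrAC.
    have -> : 2 * B * 2 = 4 * B by ring.
    by rewrite lerDr ltW.
  rewrite ler_wpM2l ?divr_ge0// ?(ltW a0)//.
  have dm0 : 0 <= delta / M by rewrite divr_ge0// ltW.
  by apply: ge0_ler_powR; rewrite ?nnegrE// ?(ltW theta0)// (le_trans dm0).
Qed.

End HolderRegularity.

(** * Hölder exponents on the circle *)

Section CircleFacts.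
Variable R : realType.

Lemma circle_mul_proj (r : nat) (t : R) :
  circle_mul r (circle_proj t) = circle_proj (r%:R * t).
Proof.
rewrite /circle_mul; elim: r => [|r IH]; first by rewrite mul0r circle_proj0.
by rewrite mulrS IH -circle_projD -natr1 mulrDl mul1r addrC.
Qed.

Lemma circle_proj_periodic (t : R) : circle_proj (t + 1) = circle_proj t.
Proof. by apply/circle_proj_eq; rewrite addrAC subrr add0r rpred1. Qed.

(** Taking logarithms in the Hölder bound gives a quotient at least
    [theta + ln C / ln D], with [D] the distance, and the last term vanishes as
    [D] goes to [0]. *)
Lemma holder_exponent_ge (w : circle R -> R) (theta : R) (x : circle R) :
  holder_at theta w x -> (theta%:E <= holder_exponent w x)%E.
Proof.
move=> [C C0 wC]; rewrite /holder_exponent limf_einfE.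
apply/lee_subgt0Pr => e e0.
(* the distance below which [|ln C|] is at most [e * |ln D|] *)
pose d := Num.min 1 (expR (- (`|ln C| / e))).
have d0 : 0 < d by rewrite lt_min ltr01 expR_gt0.
apply: le_trans (ereal_sup_ubound _); last first.
  exists [set y | [/\ y != x, mdist x y < d &
    `|w x - w y| <= C * mdist x y `^ theta]] => //.
  rewrite /dnbhs /within /=; near=> y => yx; split => //; near: y => //.
  by rewrite -nbhs_ballE; exists d => //= y; rewrite ballEmdist.
apply: le_ereal_inf_tmp => _ [y [yx yd yC] <-]; rewrite /holder_quotient.
case: eqVneq => [_|wyx]; first by rewrite leey.
have D0 : 0 < mdist x y by rewrite mdist_gt0 eq_sym.
move: yd yC; set D := mdist x y in D0 * => Dd wD.
have w0 : 0 < `|w x - w y| by rewrite normr_gt0 subr_eq0 eq_sym.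
have lnD : ln D < 0.
  by rewrite ln_lt0// D0/= (lt_le_trans Dd)// ge_min lexx.
have lnDe : ln D <= - (`|ln C| / e).
  rewrite -[leRHS]expRK ler_ln ?posrE ?expR_gt0//.
  by rewrite ltW// (lt_le_trans Dd)// ge_min lexx orbT.
have lnw : ln `|w x - w y| <= ln C + theta * ln D.
  by rewrite -ln_powR -lnM ?posrE ?powR_gt0// ler_ln ?posrE ?mulr_gt0 ?powR_gt0.
rewrite -EFinB lee_fin ler_ndivlMr//; apply: le_trans lnw _.
rewrite mulrBl addrC lerD2l -mulNr; apply: le_trans (ler_norm _) _.
by rewrite mulNr -mulrN -ler_pdivrMl// mulrC lerNr.
Unshelve. all: by end_near.
Qed.

End CircleFacts.

(** * Bounded solutions on the circle *)

Section LiftedData.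
Variables (R : realType) (f : circle R -> circle R) (lambda theta : R).
Variables (v : circle R -> R) (r : nat).
Hypotheses (fC2 : Ck_circle_map 2 f) (vC1 : Ck_circle_fun 1 v).
Hypothesis lambda_le : forall y, lambda <= circle_derive f y.
Hypotheses (lambda1 : 1 < lambda) (theta0 : 0 < theta) (theta1 : theta < 1).

Let v_periodic t : (v \o @circle_proj R) (t + 1) = (v \o @circle_proj R) t.
Proof. by rewrite /= circle_proj_periodic. Qed.

Lemma circle_C1_bounded : exists2 K, 0 < K & forall x, `|v x| <= K.
Proof.
have vc : continuous (v \o @circle_proj R).
  by apply: derivable_continuous; exact: (vC1.1 0%N isT).
have [K K0 vK] := continuous_periodic_bounded v_periodic vc.
by exists K => // x; rewrite -(circle_reprK x); exact: vK.
Qed.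

Lemma bounded_solution_holder (alpha : circle R -> R) :
  bounded_solution f theta (v \o circle_mul r) alpha ->
  exists2 C, 0 < C & forall x y, `|alpha x - alpha y| <= C * mdist x y `^ theta.
Proof.
move=> [ab aE]; have [F fF [Fd Fc]] := fC2.
have gE t : circle_derive f (circle_proj t) = derive1 F t.
  by apply: circle_derive_lift => //; exact: (Fd 0%N isT).
have g_periodic t : derive1 F (t + 1) = derive1 F t.
  by rewrite -!gE circle_proj_periodic.
have gC1 : Ck 1 (derive1 F).
  by apply: Ck_derive1; split.
have gc : continuous (derive1 F).
  by apply: derivable_continuous; exact: (gC1.1 0%N isT).
have [M M0 gM] := continuous_periodic_bounded g_periodic gc.
have [k k0 gk] := C1_periodic_lipschitz g_periodic gC1.
have [l l0 vl] := C1_periodic_lipschitz v_periodic vC1.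
have [B B0 aB] := ex_strict_bound_gt0 ab.
pose A t := alpha (circle_proj t).
pose W t := v (circle_mul r (circle_proj t)).
have [C C0 AC] : exists2 C, 0 < C &
    forall s t, `|A s - A t| <= C * `|s - t| `^ theta.
  apply: (@twisted_equation_holder _ F (derive1 F) A W theta lambda M k
    (l * r%:R) B) => //.
  - by rewrite mulr_ge0// ltW.
  - by move=> t; rewrite -gE.
  - by move=> t; exact: le_trans (ler_norm _) (gM t).
  - by apply: mean_value; exact: (Fd 0%N isT).
  - move=> s t; rewrite /W !circle_mul_proj; apply: le_trans (vl _ _) _.
    by rewrite -mulrBr normrM normr_nat mulrA.
  - by move=> t; exact/ltW/aB.
  - by move=> t; rewrite /A -fF -gE; exact: aE.
exists C => // x y.
have -> : y = circle_proj (circle_repr x + circle_repr (y - x)).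
  by rewrite circle_projD !circle_reprK addrC subrK.
rewrite -{1}(circle_reprK x); apply: le_trans (AC _ _) _.
rewrite opprD addrA subrr add0r normrN circle_mdistE.
by rewrite circle_projD !circle_reprK [x + _]addrC subrK.
Qed.

End LiftedData.

Unset Implicit Arguments.
Set Strict Implicit.

Theorem theorem3 (R : realType) (f : circle R -> circle R)
    (lambda theta : R) (v : circle R -> R) (r : nat)
    (fC2 : Ck_circle_map 2 f)
    (lambda_min : (exists y, circle_derive f y = lambda) /\
                  (forall y, lambda <= circle_derive f y))
    (lambda_gt1 : 1 < lambda)
    (theta_gt0 : 0 < theta) (theta_lt1 : theta < 1)
    (vC1 : Ck_circle_fun 1 v)
    (r_gt0 : (0 < r)%N) :
  (exists! alpha : circle R -> R,
     bounded_solution f theta (v \o circle_mul r) alpha) /\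
  (forall alpha : circle R -> R,
     bounded_solution f theta (v \o circle_mul r) alpha ->
     (forall x, holder_at theta alpha x) /\
     (forall x, (theta%:E <= holder_exponent alpha x)%E)).
Proof.
have [_ lambda_le] := lambda_min.
split; last first.
  move=> alpha alphaP.
  have [C C0 aC] := bounded_solution_holder fC2 vC1 lambda_le
    lambda_gt1 theta_gt0 theta_lt1 alphaP.
  have alphaH x : holder_at theta alpha x.
    by exists C => //; apply/nbhs_ballP; exists 1 => //= y _; exact: aC.
  by split=> // x; exact: holder_exponent_ge.
have [K _ vK] := circle_C1_bounded vC1.
pose c := lambda `^ theta.
have c1 : 1 < c by exact: powR_gt1.
have psic x : c <= circle_derive f x `^ theta.
  have l0 : 0 <= lambda by rewrite ltW// (lt_trans _ lambda_gt1).
  by apply: ge0_ler_powR; rewrite ?nnegrE ?(ltW theta_gt0)// (le_trans l0).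
have boundedP (alpha : circle R -> R) :
    bounded_fun alpha <-> exists L, forall x, `|alpha x| <= L.
  split=> [/ex_strict_bound_gt0[L _ aL]|[L aL]].
    by exists L => x; exact/ltW/aL.
  exists L; split; first exact: num_real.
  by move=> M LM x _; exact: le_trans (aL x) (ltW LM).
have wK x : `|(v \o circle_mul r) x| <= K by exact: vK.
have [alpha [alphaK alphaE]] := twisted_equation_solvable f c1 psic wK.
exists alpha; split; first by split=> //; exact/boundedP.
move=> beta [/boundedP betaK betaE].
exact: (twisted_equation_unique c1 psic alphaK betaK alphaE betaE).
Qed.
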